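(* Let $X$ be a Banach space such that $C([0,1]^d)$ is continuously embedded in $X$, and let $\mathcal K\subset X$ be compact. Let $\sigma$ be a Lipschitz sigmoidal function or $\mathrm{ReLU}$, and let the bound $w$ on the parameters satisfy $w(W)\ge1$. Let $\alpha>0$, $\beta\in\mathbb R$. Then $$\epsilon_n(\mathcal K)_X\gtrsim\frac{(\log_2 n)^\beta}{n^{\alpha}},\ n\in\mathbb N\ \Rightarrow\ E(\mathcal K,\Xi_{W,\sigma}(w(W)))_X\gtrsim\frac{[\log_2 W+\log_2(\log_2W+\log_2w(W))]^{\beta}}{[W(\log_2W+\log_2w(W))]^{\alpha}},\ W\in\mathbb N,$$ $$\epsilon_n(\mathcal K)_X\gtrsim[\log_2 n]^{-\alpha},\ n\in\mathbb N\ \Rightarrow\ E(\mathcal K,\Xi_{W,\sigma}(w(W)))_X\gtrsim[\log_2W+\log_2(\log_2W+\log_2w(W))]^{-\alpha},\ W\in\mathbb N.$$ In particular, if $w(W)=CW^\delta$ with $C>0$, $\delta\ge0$, then $$\epsilon_n(\mathcal K)_X\gtrsim[\log_2 n]^\beta n^{-\alpha},\ n\in\mathbb N\ \Rightarrow\ E(\mathcal K,\Xi_{W,\sigma}(CW^\delta))_X\gtrsim[\log_2 W]^{\beta-\alpha}W^{-\alpha},\ W\in\mathbb N,$$ $$\epsilon_n(\mathcal K)_X\gtrsim[\log_2 n]^{-\alpha},\ n\in\mathbb N\ \Rightarrow\ E(\mathcal K,\Xi_{W,\sigma}(CW^\delta))_X\gtrsim[\log_2 W]^{-\alpha},\ W\in\mathbb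 N,$$ and if $w(W)=C2^{cW^\nu}$ with $C\ge1$, $c>0$, $\nu>0$, then $$\epsilon_n(\mathcal K)_X\gtrsim[\log_2 n]^\beta n^{-\alpha},\ n\in\mathbb N\ \Rightarrow\ E(\mathcal K,\Xi_{W,\sigma}(C2^{cW^\nu}))_X\gtrsim[\log_2 W]^{\beta}W^{-(1+\nu)\alpha},\ W\in\mathbb N,$$ $$\epsilon_n(\mathcal K)_X\gtrsim[\log_2 n]^{-\alpha},\ n\in\mathbb N\ \Rightarrow\ E(\mathcal K,\Xi_{W,\sigma}(C2^{cW^\nu}))_X\gtrsim[\log_2 W]^{-\alpha},\ W\in\mathbb N.$$
   Context: Shallow neural networks. Fix $d\ge1$ and an activation function $\sigma:\mathbb R\to\mathbb R$ which is either $\mathrm{ReLU}(t)=\max\{0,t\}$, or an $L$-Lipschitz sigmoidal function; the only properties of the latter that are used are $|\sigma(t)|\le 1$ and $|\sigma(t_1)-\sigma(t_2)|\le L|t_1-t_2|$ for all $t,t_1,t_2\in\mathbb R$. For a width $W\ge2$ let $\bar\sigma:\mathbb R^W\to\mathbb R^W$ be $\sigma$ applied coordinatewise. For affine mappings $A^{(0)}:\mathbb R^d\to\mathbb R^W$, $A^{(1)}:\mathbb R^W\to\mathbb R$ let $y\in\mathbb R^{\widetilde W}$, $\widetilde W=W(d+1)+W+1$, list in a fixed order all entries of their matrices and offset vectors, and define on $[0,1]^d$ the function $\Psi_\sigma(y):=A^{(1)}\circ\bar\sigma\circ A^{(0)}$. Put $\Xi_{W,\sigma}(w(W)):=\{\Psi_\sigma(y):\|y\|_{\ell_\infty^{\widetilde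 W}}\le w(W)\}$, $E(f,\Xi_{W,\sigma}(w(W)))_X:=\inf_{\|y\|_{\ell_\infty^{\widetilde W}}\le w(W)}\|f-\Psi_\sigma(y)\|_X$ for $W\ge2$ (and $:=\|f\|_X$ for $W=0,1$), and $E(\mathcal K,\Xi_{W,\sigma}(w(W)))_X:=\sup_{f\in\mathcal K}E(f,\Xi_{W,\sigma}(w(W)))_X$. Entropy numbers: $\epsilon_n(\mathcal K)_X$, $n\ge0$, is the infimum of all $\epsilon>0$ for which $\mathcal K$ is covered by $2^n$ balls of radius $\epsilon$ with centers in $X$. Asymptotic notation: for expressions $A,B$ depending on $n$ (respectively $W$), $A\gtrsim B$ means that there is a constant $c>0$ independent of $n$ (respectively $W$) with $A\ge cB$ as $n\to\infty$ (respectively $W\to\infty$), i.e. for all sufficiently large values, so that the logarithmic expressions are well defined. *)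

(* Defs.v *)
From HB Require Import structures.
From mathcomp Require Import all_boot all_order all_algebra.
From mathcomp Require Import all_classical all_reals all_analysis.
Set Implicit Arguments.
Unset Strict Implicit.
Unset Printing Implicit Defensive.
Import Order.TTheory GRing.Theory Num.Theory.
Import numFieldNormedType.Exports.
Local Open Scope classical_set_scope.
Local Open Scope ring_scope.

Definition cube (R : realType) (d : nat) : set 'rV[R]_d :=
  [set x | forall i, `[0, 1]%classic (x ord0 i)].
Arguments cube : clear implicits.

(** C([0,1]^d) as a normed module with the maximum norm. *)
Section ContinuousFunctions.
Variables (R : realType) (d : nat).

Definition ccube_pred : {pred set_type (cube R d) -> R} :=
  mem [set f : set_type (cube R d) -> R | continuous f].

Record ccube := CCube {
  ccube_fun :> set_type (cube R d) -> R;
  ccube_cont : ccube_fun \in ccube_pred }.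

HB.instance Definition _ := [isSub for ccube_fun].
HB.instance Definition _ := gen_eqMixin ccube.
HB.instance Definition _ := gen_choiceMixin ccube.

Lemma ccubeP (f : ccube) : continuous f.
Proof. by have := ccube_cont f; rewrite inE. Qed.

Lemma ccube_submod_closed : submod_closed ccube_pred.
Proof.
split=> [|a f g]; rewrite !inE /=; first by move=> x; exact: cst_continuous.
move=> cf cg x; apply: (@continuousD _ R); last exact: cg.
by apply: (@continuousM _ _ (cst a)); [exact: cst_continuous|exact: cf].
Qed.

HB.instance Definition _ :=
  GRing.isSubmodClosed.Build R (set_type (cube R d) -> R) ccube_pred
    ccube_submod_closed.
HB.instance Definition _ := [SubChoice_isSubLmodule of ccube by <:].

Lemma cube_compact : compact (cube R d).
Proof.
apply: (@rV_compact R d (fun=> `[0, 1]%classic)) => i.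
exact: segment_compact.
Qed.

Lemma cube0 : cube R d 0.
Proof. by move=> i; rewrite /= mxE in_itv /= lexx ler01. Qed.

Let cube_pt : set_type (cube R d) := exist _ 0 (mem_set cube0).

Definition ccube_norm (f : ccube) : R := sup (range (fun x => `|f x|)).

Lemma ccube_has_sup (f : ccube) : has_sup (range (fun x => `|f x|)).
Proof.
split; first by exists `|f cube_pt|; exists cube_pt.
have /subspace_valL_continuousP cf := @ccubeP f.
have /compact_bounded[M [_ hM]] := continuous_compact cf cube_compact.
exists (M + 1) => _ [x _ <-]; apply: hM; first by rewrite ltrDl.
exists (set_val x); first exact: set_valP.
by have /(congr1 (@^~ x)) := @valLK _ _ point _ (f : set_type _ -> R).
Qed.

Lemma ccube_le_norm (f : ccube) x : `|f x| <= ccube_norm f.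
Proof. by apply: sup_upper_bound; [exact: ccube_has_sup|exists x]. Qed.

Lemma ccube_norm_le (f : ccube) (M : R) :
  (forall x, `|f x| <= M) -> ccube_norm f <= M.
Proof.
move=> fM; apply: ge_sup => [|_ [x _ <-]]; last exact: fM.
exact: (ccube_has_sup f).1.
Qed.

Lemma ccube_normD f g : ccube_norm (f + g) <= ccube_norm f + ccube_norm g.
Proof.
apply: ccube_norm_le => x; apply: (le_trans (ler_normD (f x) (g x))).
by apply: lerD; exact: ccube_le_norm.
Qed.

Lemma ccube_norm_eq0 f : ccube_norm f = 0 -> f = 0.
Proof.
move=> f0; apply/val_inj/funext => x.
by apply/eqP; rewrite -normr_le0 -f0; exact: ccube_le_norm.
Qed.

Lemma ccube_normZ (a : R) f : ccube_norm (a *: f) = `|a| * ccube_norm f.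
Proof.
have le (b : R) g : ccube_norm (b *: g) <= `|b| * ccube_norm g.
  apply: ccube_norm_le => x.
  have -> : (b *: g : ccube) x = b * g x by [].
  by rewrite normrM ler_wpM2l// ccube_le_norm.
apply/le_anti; rewrite le /=; have [->|a0] := eqVneq a 0.
  rewrite normr0 mul0r; apply: le_trans (ccube_le_norm _ cube_pt).
  exact: normr_ge0.
rewrite -ler_pdivlMl ?normr_gt0// -normfV.
by rewrite -{1}[f](scalerK a0); exact: le.
Qed.

HB.instance Definition _ :=
  Lmodule_isNormed.Build R ccube ccube_normD ccube_normZ ccube_norm_eq0.

End ContinuousFunctions.
Arguments ccube : clear implicits.

Section Networks.
Variable R : realType.

Definition relu (t : R) : R := Num.max 0 t.

(** No limits at infinity are imposed: boundedness by 1 and the Lipschitz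
    estimate are the only properties that matter here. *)
Definition lipschitz_sigmoidal (s : R -> R) : Prop :=
  (forall t, `|s t| <= 1) /\
  exists L : R, forall t1 t2, `|s t1 - s t2| <= L * `|t1 - t2|.

Definition activation (s : R -> R) : Prop := s = relu \/ lipschitz_sigmoidal s.

(** The coordinates of [y] are, in this order: row by row, the W x (d + 1)
    matrix whose first d columns are the linear part of A^(0) and whose last
    column is its offset; the linear part of A^(1); the offset of A^(1).
    The norm of ['rV_n] is the maximum norm. *)
Definition params (d W : nat) := 'rV[R]_(W * (d + 1) + W + 1).

Definition inner_layer d W (y : params d W) : 'M[R]_(W, d + 1) :=
  vec_mx (lsubmx (lsubmx y)).

Definition affine0 d W (y : params d W) (x : 'rV[R]_d) : 'cV[R]_W :=
  lsubmx (inner_layer y) *m x^T + rsubmx (inner_layer y).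

Definition affine1 d W (y : params d W) (z : 'cV[R]_W) : R :=
  (rsubmx (lsubmx y) *m z + rsubmx y) ord0 ord0.

Definition network d W (s : R -> R) (y : params d W) (x : 'rV[R]_d) : R :=
  affine1 y (map_mx s (affine0 y x)).

Lemma activation_continuous s : activation s -> continuous s.
Proof.
case=> [->|[_ [L sL]]] x.
  apply: continuous_max; [exact: cst_continuous|exact: id].
apply/cvgrPdist_le => /= e e0; have L0 : 0 < `|L| + 1 by rewrite ltr_wpDl.
near=> t; apply: le_trans (sL _ _) _.
apply: (@le_trans _ _ ((`|L| + 1) * `|x - t|)).
  by rewrite ler_wpM2r// (le_trans (ler_norm L))// lerDl.
rewrite -ler_pdivlMl//; near: t.
by apply: cvgr_dist_le => //; rewrite mulr_gt0 ?invr_gt0.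
Unshelve. all: by end_near. Qed.

Lemma continuous_sum_ord (T : topologicalType) n (F : 'I_n -> T -> R) :
  (forall i, continuous (F i)) -> continuous (fun x => \sum_i F i x).
Proof.
elim: n F => [F _|n IHn F cF] x.
  by under eq_fun do rewrite big_ord0; exact: cst_continuous.
under eq_fun do rewrite big_ord_recl.
apply: (@continuousD _ R); first exact: cF.
exact: (IHn (fun i => F (lift ord0 i))).
Qed.

Lemma affine0_continuous d W (y : params d W) j :
  continuous (fun x => affine0 y x j ord0).
Proof.
rewrite (_ : (fun x => affine0 y x j ord0) = fun x : 'rV[R]_d =>
    \sum_k lsubmx (inner_layer y) j k * x ord0 k
    + rsubmx (inner_layer y) j ord0); last first.
  apply/funext => x; rewrite /affine0 2!mxE.
  by under eq_bigr do rewrite [_^T _ _]mxE.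
move=> x; apply: (@continuousD _ R); last exact: cst_continuous.
apply: continuous_sum_ord => k {}x.
apply: (@continuousM _ _ (cst _)); first exact: cst_continuous.
exact: coord_continuous.
Qed.

Lemma network_continuous d W s (y : params d W) :
  continuous s -> continuous (network s y).
Proof.
move=> cs; rewrite (_ : network s y = fun x =>
    \sum_j rsubmx (lsubmx y) ord0 j * s (affine0 y x j ord0)
    + rsubmx y ord0 ord0); last first.
  apply/funext => x; rewrite /network /affine1 2!mxE.
  by under eq_bigr do rewrite [map_mx _ _ _ _]mxE.
move=> x; apply: (@continuousD _ R); last exact: cst_continuous.
apply: continuous_sum_ord => j {}x.
apply: (@continuousM _ _ (cst _)); first exact: cst_continuous.
apply: (@continuous_comp _ R R (fun x => affine0 y x j ord0) s).
  exact: affine0_continuous.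
exact: cs.
Qed.

Lemma network_in d W s (y : params d W) : activation s ->
  network s y \o set_val \in @ccube_pred R d.
Proof.
move=> /activation_continuous cs; rewrite inE => x.
apply: (@continuous_comp (set_type (cube R d)) _ R).
  exact: initial_continuous.
exact: network_continuous.
Qed.

Definition Psi d W (s : R -> R) (hs : activation s) (y : params d W) :
  ccube R d := CCube (network_in y hs).

Definition Xi d W (s : R -> R) (hs : activation s) (r : R) : set (ccube R d) :=
  [set Psi hs y | y in [set y : params d W | `|y| <= r]].

End Networks.

Section Approximation.
Variables (R : realType) (X : completeNormedModType R).

(** Infimum of the radii of 2^n balls covering [K]; it does not depend on
    whether the balls are open or closed. *)
Definition entropy_number (K : set X) (n : nat) : \bar R :=
  ereal_inf [set e%:E | e in [set e : R | 0 < e /\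
    exists c : 'I_(2 ^ n) -> X, K `<=` \bigcup_i ball (c i) e]].

(** Networks have width at least 2; for [W < 2] the error is the norm of [f]
    by convention. *)
Definition approx_error d (iota : ccube R d -> X) (s : R -> R)
    (hs : activation s) (W : nat) (r : R) (f : X) : \bar R :=
  if (W < 2)%N then `|f|%:E
  else ereal_inf [set `|f - iota g|%:E | g in @Xi R d W s hs r].

Definition class_error d (iota : ccube R d -> X) (s : R -> R)
    (hs : activation s) (K : set X) (w : nat -> R) (W : nat) : \bar R :=
  ereal_sup [set approx_error iota hs W (w W) f | f in K].

End Approximation.

Definition asymp_ge (R : realType) (A : nat -> \bar R) (B : nat -> R) : Prop :=
  exists2 c : R, 0 < c & \forall n \near \oo, ((c * B n)%:E <= A n)%E.

Definition log2 (R : realType) (x : R) : R := ln x / ln 2.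

(* Main.v *)
Require Import Defs.
From mathcomp Require Import all_boot all_order all_algebra.
From mathcomp Require Import all_classical all_reals all_analysis.
From mathcomp Require Import zify lra ring.
Set Implicit Arguments.
Unset Strict Implicit.
Unset Printing Implicit Defensive.
Import Order.TTheory GRing.Theory Num.Theory.
Import numFieldNormedType.Exports.
Local Open Scope classical_set_scope.
Local Open Scope ring_scope.

(** A network of width [W] depends on O(W) parameters of size at most [w], and
    on [0,1]^d it is Lipschitz in them with constant O(W w).  Rounding every
    parameter to [q] bits therefore produces 2^(q O(W)) functions, and if every
    element of [K] is within [e] of a network, the balls of radius
    e + O(W w^2 / 2^q) around these functions cover [K].  With
    q = k (log2 W + log2 w) and k a large constant the rounding error is
    negligible against any rate polylogarithmic and polynomial in W log2 (W w),
    so a class error below such a rate would contradict the lower bound on the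
    entropy numbers at n ~ W (log2 W + log2 w). *)

(** * Lipschitz dependence on the parameters and covering by quantized networks *)

Section Covering.
Variable R : realType.

Lemma row_norm_coord n (y : 'rV[R]_n) i : `|y ord0 i| <= `|y|.
Proof.
rewrite [leRHS]mx_normrE.
exact: (le_bigmax _ (fun ij : 'I_1 * 'I_n => `|y ij.1 ij.2|) (ord0, i)).
Qed.

Lemma row_norm_le n (y : 'rV[R]_n) r :
  0 <= r -> (forall i, `|y ord0 i| <= r) -> `|y| <= r.
Proof.
move=> r0 yr; rewrite [leLHS]mx_normrE.
by apply: bigmax_le => //= -[i j] _ /=; rewrite ord1.
Qed.

(** ReLU and sigmoidal functions enter the estimates only through linear growth and a nonnegative
    Lipschitz constant, so both cases are treated at once. *)
Lemma activation_bounds (s : R -> R) : activation s ->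
  exists2 L : R, 0 <= L & (forall t, `|s t| <= 1 + `|t|) /\
    forall t u, `|s t - s u| <= L * `|t - u|.
Proof.
case=> [->|[s1 [L sL]]].
  exists 1 => //; split=> [t|t u].
    rewrite /relu ger0_norm ?le_max ?lexx// ge_max.
    by rewrite addr_ge0//= (le_trans (ler_norm t))// lerDr.
  have tu := ler_norm (t - u); have := ler_norm (u - t); rewrite distrC => ut.
  by rewrite mul1r /relu ler_norml !maxEle; case: ifP => ?; case: ifP => ?; lra.
exists `|L|; first exact: normr_ge0.
split=> [t|t u]; first by rewrite (le_trans (s1 t))// lerDl.
by rewrite (le_trans (sL t u))// ler_wpM2r// ler_norm.
Qed.

Definition out_weight d W (y : params R d W) (j : 'I_W) : R :=
  rsubmx (lsubmx y) ord0 j.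
Definition out_offset d W (y : params R d W) : R := rsubmx y ord0 ord0.

Lemma out_weight_le d W (y : params R d W) j : `|out_weight y j| <= `|y|.
Proof. by rewrite /out_weight !mxE; exact: row_norm_coord. Qed.

Lemma out_offset_le d W (y : params R d W) : `|out_offset y| <= `|y|.
Proof. by rewrite /out_offset !mxE; exact: row_norm_coord. Qed.

Lemma networkE d W s (y : params R d W) x :
  network s y x =
  \sum_j out_weight y j * s (affine0 y x j ord0) + out_offset y.
Proof.
rewrite /network /affine1 2!mxE.
by under eq_bigr do rewrite [map_mx _ _ _ _]mxE.
Qed.

Lemma affine0_le d W (y : params R d W) x r j :
  `|y| <= r -> cube R d x -> `|affine0 y x j ord0| <= d.+1%:R * r.
Proof.
move=> yr cx; have coord i : `|y ord0 i| <= r.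
  exact: le_trans (row_norm_coord y i) yr.
rewrite /affine0 2!mxE (le_trans (ler_normD _ _))//.
rewrite -natr1 mulrDl mul1r lerD//; last by rewrite !mxE; exact: coord.
apply: le_trans (ler_norm_sum _ _ _) _.
have -> : d%:R * r = \sum_(k < d) r by rewrite sumr_const card_ord mulr_natl.
apply: ler_sum => k _.
rewrite normrM !mxE -[leRHS]mulr1; apply: ler_pM => //.
have := cx k; rewrite /= in_itv /= => /andP[x0 x1].
by rewrite ger0_norm.
Qed.

(** The input of a hidden unit is linear in the parameters, so [affine0_le] also bounds its
    increments. *)
Lemma affine0B d W (y z : params R d W) x j :
  affine0 y x j ord0 - affine0 z x j ord0 = affine0 (y - z) x j ord0.
Proof.
by rewrite /affine0 /inner_layer !linearB/= mulmxBl !mxE; ring.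
Qed.

(** Each summand of the output varies through its weight and through its hidden unit; both effects
    are O(r) times [|y - z|], and summing over the units gives the factor W. [Lam] depends on
    neither W nor r. *)
Lemma network_lipschitz d (s : R -> R) : activation s ->
  exists2 Lam : R, 0 < Lam & forall W (y z : params R d W) r x,
    (0 < W)%N -> 1 <= r -> `|y| <= r -> `|z| <= r -> cube R d x ->
    `|network s y x - network s z x| <= Lam * W%:R * r * `|y - z|.
Proof.
move=> /activation_bounds[L L0 [s1 sL]].
(* A hidden unit is at most 1 + (d+1) r <= (d+2) r in absolute value, as 1 <= r; its variation gives
   [L * d.+1%:R], and the output offset gives 1. *)
exists (d.+2%:R + L * d.+1%:R + 1); first by rewrite ltr_wpDl// addr_ge0// mulr_ge0.
move=> W y z r x W0 r1 yr zr cx; set e := `|y - z|.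
have r0 : 0 <= r by lra.
have e0 : 0 <= e by exact: normr_ge0.
have B j : `|out_weight y j * s (affine0 y x j ord0)
             - out_weight z j * s (affine0 z x j ord0)|
           <= (d.+2%:R + L * d.+1%:R) * r * e.
  rewrite (_ : _ - _ =
    (out_weight y j - out_weight z j) * s (affine0 y x j ord0)
    + out_weight z j * (s (affine0 y x j ord0) - s (affine0 z x j ord0)));
    last by ring.
  rewrite (le_trans (ler_normD _ _))//.
  rewrite -mulrA [leRHS]mulrDl mulrA lerD//.
    rewrite normrM mulrC; apply: ler_pM => //.
      rewrite (le_trans (s1 _))// -(natr1 d.+1) mulrDl mul1r addrC lerD//.
      exact: affine0_le.
    have -> : out_weight y j - out_weight z j = out_weight (y - z) j.
      by rewrite /out_weight !linearB/= !mxE.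
    exact: out_weight_le.
  rewrite normrM (_ : L * _ * (r * e) = r * (L * (d.+1%:R * e))); last by ring.
  apply: ler_pM => //.
    exact: le_trans (out_weight_le z j) zr.
  rewrite (le_trans (sL _ _))// ler_wpM2l// affine0B.
  exact: affine0_le.
rewrite !networkE opprD addrACA -sumrB (le_trans (ler_normD _ _))//.
rewrite -!mulrA [leRHS]mulrDl mul1r lerD//.
  apply: le_trans (ler_norm_sum _ _ _) _.
  apply: le_trans (ler_sum _ (fun j _ => B j)) _.
  by rewrite sumr_const card_ord -mulr_natl; lra.
have -> : out_offset y - out_offset z = out_offset (y - z).
  by rewrite /out_offset !linearB/= !mxE.
apply: (@le_trans _ _ e).
  exact: out_offset_le.
have W1 : 1 <= W%:R :> R by rewrite ler1n.
by rewrite mulrA -[leLHS]mul1r ler_wpM2r//; nra.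
Qed.

(** Rounding down to a grid of mesh 2r/N that starts at -r. *)
Lemma interval_net N (r t : R) : (0 < N)%N -> 0 < r -> `|t| <= r ->
  exists k : 'I_N, `|t - (r * (k%:R *+ 2 / N%:R) - r)| <= r * 2 / N%:R.
Proof.
case: N => // N _ r0 /ler_normlP[t1 t2]; have N0 : 0 < N.+1%:R :> R by [].
have NS : N.+1%:R = N%:R + 1 :> R by rewrite natr1.
set u := (t + r) * N.+1%:R / (r * 2).
have u0 : 0 <= u by rewrite divr_ge0 ?mulr_ge0//; lra.
have tu : t = r * (u *+ 2 / N.+1%:R) - r.
  rewrite /u; move: (N.+1%:R : R) N0 => n n0; field.
  by rewrite (gt_eqF r0) (gt_eqF n0).
have uN : u <= N.+1%:R.
  by rewrite ler_pdivrMr ?mulr_gt0//; nra.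
have close (k : R) : k <= u <= k + 1 ->
    `|t - (r * (k *+ 2 / N.+1%:R) - r)| <= r * 2 / N.+1%:R.
  move=> /andP[ku uk1]; rewrite {1}tu.
  rewrite (_ : _ - _ = r * 2 / N.+1%:R * (u - k)); last by ring.
  rewrite normrM ger0_norm; last by rewrite divr_ge0// mulr_ge0// ltW.
  rewrite -[leRHS]mulr1 ler_wpM2l//; first by rewrite divr_ge0// mulr_ge0// ltW.
  by rewrite ger0_norm; lra.
have /andP[k1 k2] := truncn_itv u0.
have [kN|Nk] := ltnP (Num.truncn u) N.+1.
  exists (Ordinal kN); apply: close => /=.
  by rewrite k1/= natr1 ltW.
(* Only t = r reaches this case: rounding down would give the excluded right endpoint, and the last
   grid point is exactly one mesh away. *)
exists ord_max; apply: close => /=; rewrite -NS uN andbT.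
by rewrite (le_trans _ k1)// ler_nat ltnW.
Qed.

(** A product of grids with 2^q points per coordinate. The centres must stay in the ball because the
    Lipschitz bound for networks is stated for parameters bounded by r. *)
Lemma ball_net q n (r : R) : 0 < r ->
  exists c : 'I_(2 ^ (q * n)) -> 'rV[R]_n, (forall i, `|c i| <= r) /\
    forall y, `|y| <= r -> exists i, `|y - c i| <= r * 2 / (2 ^ q)%:R.
Proof.
move=> r0; have N0 : (0 < 2 ^ q)%N by rewrite expn_gt0.
pose g (k : 'I_(2 ^ q)) : R := r * (k%:R *+ 2 / (2 ^ q)%:R) - r.
have gr k : `|g k| <= r.
  have k0 : 0 <= (k%:R / (2 ^ q)%:R : R) by rewrite divr_ge0.
  have k1 : (k%:R / (2 ^ q)%:R : R) <= 1.
    by rewrite ler_pdivrMr ?ltr0n// mul1r ler_nat ltnW.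
  rewrite (_ : g k = r * (k%:R / (2 ^ q)%:R *+ 2 - 1)); last first.
    by rewrite /g mulrnAl mulrBr mulr1.
  rewrite normrM gtr0_norm// -[leRHS]mulr1 ler_wpM2l ?(ltW r0)//.
  by rewrite ler_norml; lra.
have card : (2 ^ (q * n) = #|{ffun 'I_n -> 'I_(2 ^ q)}|)%N.
  by rewrite card_ffun !card_ord expnM.
exists (fun i => \row_j g (enum_val (cast_ord card i) j)); split=> [i|y yr].
  by apply: row_norm_le (ltW r0) _ => j; rewrite mxE.
have /choice[k kP] j := interval_net N0 r0 (le_trans (row_norm_coord y j) yr).
exists (cast_ord (esym card) (enum_rank [ffun j => k j])).
apply: row_norm_le => [|j]; first by rewrite divr_ge0// mulr_ge0// ltW.
by rewrite !mxE cast_ordKV enum_rankK ffunE.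
Qed.

Definition nparams d W := (W * (d + 1) + W + 1)%N.

(* Quantized parameters give centres: an [f] within [e] of a network is within
   [e] plus the quantization error of one of finitely many networks. *)
Lemma entropy_le_class_error d (X : completeNormedModType R)
    (iota : {linear ccube R d -> X}) (s : R -> R) (hs : activation s) :
  continuous iota ->
  exists2 A : R, 0 < A & forall (K : set X) w W q (e : R),
    (2 <= W)%N -> 1 <= w W -> 0 < e ->
    (class_error iota hs K w W < e%:E)%E ->
    (entropy_number K (q * nparams d W)
      <= (e + A * W%:R * w W ^+ 2 / 2 ^+ q)%:E)%E.
Proof.
move=> /linear_bounded_continuous /linear_boundedP[M [_ HM]].
have {HM} [M0 M0_gt0 HM] : exists2 M' : R, 0 < M' & forall g, `|iota g| <= M' * `|g|.
  (* Boundedness supplies the estimate for every constant above [M], whose sign is unknown. *)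
  exists (`|M| + 1); first by rewrite ltr_wpDl.
  by move=> g; apply: HM; rewrite ltr_pwDr// ler_norm.
have [Lam Lam0 HL] := network_lipschitz d hs.
(* The operator bound of [iota], the Lipschitz constant of the networks, and the 2 of the grid
   mesh. *)
exists (M0 * Lam * 2); first by rewrite !mulr_gt0.
move=> K w W q e W2 w1 e0 Ke.
have w0 : 0 < w W by lra.
have [c [cw cnet]] := ball_net q (nparams d W) w0.
set E := M0 * Lam * 2 * _ * _ / _.
have E0 : 0 <= E by rewrite /E !mulr_ge0 ?invr_ge0 ?exprn_ge0// ltW.
apply: ereal_inf_lbound; exists (e + E) => //; split; first by rewrite ltr_pwDl.
exists (fun i => iota (Psi hs (c i : params R d W))) => f Kf.
have : (approx_error iota hs W (w W) f < e%:E)%E.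
  by apply: le_lt_trans Ke; apply: ereal_sup_ubound; exists f.
rewrite /approx_error ltnNge W2/= => /ereal_inf_lt[_ [_ [y /= yw <-] <-]].
rewrite lte_fin => fe; have [i yc] := cnet y yw.
exists i => //; rewrite -ball_normE /= distrC.
rewrite (_ : f - _ = (f - iota (Psi hs y)) +
  (iota (Psi hs y) - iota (Psi hs (c i : params R d W)))); last first.
  by rewrite addrA subrK.
(* The distance to the network is strictly below [e], so an open ball of radius [e + E] suffices
   although the quantization estimate is not strict. *)
apply: le_lt_trans (ler_normD _ _) _; rewrite ltr_leD//.
rewrite -linearB (le_trans (HM _))//.
rewrite (_ : E = M0 * (Lam * W%:R * w W * (w W * 2 / (2 ^ q)%:R))); last first.
  by rewrite /E natrX; ring.
rewrite ler_wpM2l ?(ltW M0_gt0)//; apply: ccube_norm_le => x.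
apply: le_trans (_ : `|network s y (val x)
    - network s (c i : params R d W) (val x)| <= _).
  by [].
apply: le_trans (HL _ _ _ (w W) _ _ _ _ _ _) _ => //.
- exact: ltnW.
- exact: set_valP.
- by rewrite ler_wpM2l// !mulr_ge0// ltW.
Qed.

End Covering.

(** * Logarithms, powers and comparison of rates *)

Section Rates.
Variable R : realType.


Lemma ln2_gt0 : 0 < ln 2 :> R. Proof. by rewrite ln_gt0// ltr1n. Qed.

Lemma log2M (x y : R) : 0 < x -> 0 < y -> log2 (x * y) = log2 x + log2 y.
Proof. by move=> x0 y0; rewrite /log2 lnM ?posrE// mulrDl. Qed.

Lemma log2_2 : log2 2 = 1 :> R.
Proof. by rewrite /log2 divff// gt_eqF// ln2_gt0. Qed.

Lemma log2_powR (x a : R) : log2 (x `^ a) = a * log2 x.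
Proof. by rewrite /log2 ln_powR mulrA. Qed.

Lemma le_log2 (x y : R) : 0 < x -> x <= y -> log2 x <= log2 y.
Proof.
move=> x0 xy; have y0 := lt_le_trans x0 xy.
by rewrite /log2 ler_pM2r ?invr_gt0 ?ln2_gt0// ler_ln ?posrE.
Qed.

Lemma log2_ge0 (x : R) : 1 <= x -> 0 <= log2 x.
Proof. by move=> x1; rewrite divr_ge0 ?ln_ge0// ler1n. Qed.

Lemma log2_ge1 (x : R) : 2 <= x -> 1 <= log2 x.
Proof. by move=> x2; rewrite -log2_2 le_log2. Qed.

Lemma powR_ge1 (x a : R) : 1 <= x -> 0 <= a -> 1 <= x `^ a.
Proof. by move=> x1 a0; rewrite -[leLHS](powRr0 x) ler_powR. Qed.

Lemma powR_log2 (x : R) : 0 < x -> 2 `^ log2 x = x.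
Proof.
move=> x0; rewrite /powR pnatr_eq0/= /log2 divfK; last by rewrite gt_eqF ?ln2_gt0.
by rewrite lnK ?posrE.
Qed.

(** From ln(1/2) <= -1/2 follows ln 2 >= 1/2; combine this with ln x < x. *)
Lemma log2_le (x : R) : 0 < x -> log2 x <= 2 * x.
Proof.
move=> x0; rewrite ler_pdivrMr ?ln2_gt0//.
have : ln (1 + - (1 / 2)) <= - (1 / 2) :> R by rewrite le_ln1Dx//; lra.
have -> : 1 + - (1 / 2) = 2^-1 :> R by lra.
rewrite lnV ?posrE// => h; have := ln_sublinear x0; nra.
Qed.

(** The ratio y/x lies in [m, M]; its power is at least m^b if b >= 0 and M^b if b < 0, hence the
    minimum. *)
Lemma powR_comparable (m M b : R) : 0 < m -> 0 < M ->
  exists2 c : R, 0 < c & forall x y : R,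
    0 < x -> m * x <= y <= M * x -> c * x `^ b <= y `^ b.
Proof.
move=> m0 M0; exists (Num.min (m `^ b) (M `^ b)).
  by rewrite lt_min !powR_gt0.
move=> x y x0 /andP[mxy yMx]; have y0 : 0 < y by apply: lt_le_trans mxy; rewrite mulr_gt0.
have -> : y = y / x * x by rewrite divfK// gt_eqF.
rewrite powRM ?divr_ge0 ?(ltW x0) ?(ltW y0)// ler_wpM2r ?powR_ge0//.
have q0 : 0 < y / x by rewrite divr_gt0.
have [b0|b0] := leP 0 b.
  by rewrite ge_min ge0_ler_powR ?nnegrE ?(ltW m0) ?(ltW q0)// ler_pdivlMr.
rewrite ge_min; apply/orP; right.
rewrite -[b]opprK ![_ `^ - - b]powRN lef_pV2 ?posrE ?powR_gt0//.
by rewrite ge0_ler_powR ?nnegrE ?(ltW M0) ?(ltW q0) ?oppr_ge0 ?(ltW b0)// ler_pdivrMr.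
Qed.

Lemma powR_norm_le (y z b : R) : 1 <= y <= z -> z `^ (- `|b|) <= y `^ b.
Proof.
move=> /andP[y1 yz]; apply: (@le_trans _ _ (y `^ (- `|b|))).
  rewrite !powRN lef_pV2 ?posrE ?powR_gt0//; [|lra|lra].
  by rewrite ge0_ler_powR// nnegrE; lra.
by rewrite ler_powR// lerNl -normrN ler_norm.
Qed.

(* The two regimes of the entropy numbers are the rates with [(b, a)] equal
   to [(beta, alpha)] and [(- alpha, 0)]. *)
Definition rate (b a x : R) : R := log2 x `^ b * x `^ (- a).

(** The two factors are compared separately, so [l] need not be the logarithm of [x], only
    comparable to that of [y]. *)
Lemma rate_comparable (m1 m2 M1 M2 b a : R) :
  0 < m1 -> 0 < m2 -> 0 < M1 -> 0 < M2 ->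
  exists2 c : R, 0 < c & forall (l x y : R),
    0 < l -> 0 < x -> m1 * l <= log2 y <= M1 * l -> m2 * x <= y <= M2 * x ->
    c * (l `^ b * x `^ (- a)) <= rate b a y.
Proof.
move=> m10 m20 M10 M20.
have [c1 c10 h1] := powR_comparable b m10 M10.
have [c2 c20 h2] := powR_comparable (- a) m20 M20.
exists (c1 * c2) => [|l x y l0 x0 hl hx]; first exact: mulr_gt0.
by rewrite mulrACA ler_pM// ?h1 ?h2// mulr_ge0 ?powR_ge0// ltW.
Qed.

(** The chain 1 <= log2 x <= 2x <= P^4 accounts for 4|b|, whatever the sign of b; x <= P^3 accounts
    for 3a. *)
Lemma rate_ge_power (a b x P : R) : 0 <= a -> 2 <= P -> 2 <= x -> x <= P ^+ 3 ->
  P `^ (- (4 * `|b| + 3 * a)) <= rate b a x.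
Proof.
move=> a0 P2 x2 xP; have P0 : 0 <= P by lra.
rewrite opprD powRD; last by apply/implyP => _; rewrite gt_eqF//; lra.
apply: ler_pM; rewrite ?powR_ge0//.
  rewrite -mulrN powRrM powR_mulrn//; apply: powR_norm_le.
  have x0 : 0 < x by lra.
  rewrite log2_ge1//= (le_trans (log2_le x0))//.
  by rewrite exprS ler_pM//; lra.
rewrite -mulrN powRrM powR_mulrn//.
have x0 : 0 < x by lra.
have P30 : 0 < P ^+ 3 by exact: lt_le_trans xP.
rewrite !powRN lef_pV2 ?posrE ?powR_gt0//.
by rewrite ge0_ler_powR// nnegrE ltW.
Qed.

(** With P = W w, the hypotheses give 2^(k t) >= P^k >= P^p P^3; the cube absorbs W w^2 and leaves a
    spare factor 1/W, which later beats every constant. *)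
Lemma quantization_le (A W w p : R) k t :
  2 <= W -> 1 <= w -> 0 < A -> p + 3 <= k%:R -> log2 (W * w) <= t%:R ->
  A * W * w ^+ 2 / 2 ^+ (k * t) <= A / W * (W * w) `^ (- p).
Proof.
move=> W2 w1 A0 kp; set P := W * w => Pt.
have W0 : 0 < W by lra.
have w0 : 0 < w by lra.
have P1 : 1 <= P by rewrite /P; nra.
have P0 : 0 < P by lra.
have Pq : P `^ p * P ^+ 3 <= 2 ^+ (k * t).
  rewrite -[P ^+ 3]powR_mulrn ?(ltW P0)// -powRD; last first.
    by apply/implyP => _; rewrite gt_eqF.
  rewrite -powR_mulrn ?ler0n// natrM mulrC.
  apply: (@le_trans _ _ (P `^ k%:R)); first by rewrite ler_powR.
  by rewrite -{1}(powR_log2 P0) -powRrM ler_powR ?ler1n// ler_wpM2r.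
have Pp : 0 < P `^ p by exact: powR_gt0.
rewrite powRN ler_pdivrMr ?exprn_gt0//.
apply: (@le_trans _ _ (A / W / P `^ p * (P `^ p * P ^+ 3))); last first.
  by rewrite ler_wpM2l// !mulr_ge0 ?invr_ge0// ltW.
rewrite (_ : _ * (_ * _) = A * W * w ^+ 2 * P); last first.
  by move: Pp; rewrite /P => Pp; field; rewrite !gt_eqF.
by rewrite ler_peMr// !mulr_ge0 ?exprn_ge0// ltW.
Qed.

Lemma asymp_ge_le (A A' : nat -> \bar R) (B B' : nat -> R) (c : R) :
  0 < c -> (forall n, (2 <= n)%N -> c * B' n <= B n) ->
  (forall n, (2 <= n)%N -> (A n <= A' n)%E) -> asymp_ge A B -> asymp_ge A' B'.
Proof.
move=> c0 BB AA [e e0 AB]; exists (e * c); first exact: mulr_gt0.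
near=> n; have n2 : (2 <= n)%N by near: n; exact: nbhs_infty_ge.
apply: le_trans (AA n n2); apply: (@le_trans _ _ (e * B n)%:E).
  by rewrite lee_fin -mulrA ler_wpM2l ?BB// ltW.
by near: n.
Unshelve. all: by end_near. Qed.

End Rates.

(** * Lower bound on the class error for a general parameter bound *)

Section LowerBound.
Variables (R : realType) (d : nat) (X : completeNormedModType R).
Variables (iota : {linear ccube R d -> X}) (iota_cont : continuous iota).
Variables (K : set X) (s : R -> R) (hs : activation s).

(** A larger parameter bound admits more networks; this allows w to be replaced by max(1, w). *)
Lemma class_error_antimono (v w : nat -> R) W : v W <= w W ->
  (class_error iota hs K w W <= class_error iota hs K v W)%E.
Proof.
move=> vw; apply: ge_ereal_sup => _ [f Kf <-].
apply: le_trans (ereal_sup_ubound _); last by exists f.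
rewrite /approx_error; case: ifP => // _; apply: ereal_inf_le_tmp.
move=> _ [g [y /= yv <-] <-].
by exists (Psi hs y) => //; exists y => //; exact: le_trans yv vw.
Qed.

Lemma nparams_bounds W : (0 < W)%N -> (W <= nparams d W <= W * (d + 3))%N.
Proof. by rewrite /nparams => W0; rewrite !mulnDr; lia. Qed.

(* The number of bits per parameter, up to a constant factor. *)
Definition bits (w : nat -> R) W : R := log2 W%:R + log2 (w W).

Lemma bits_ge1 w W : (2 <= W)%N -> 1 <= w W -> 1 <= bits w W.
Proof.
move=> W2 w1; rewrite -[leLHS]addr0 lerD ?log2_ge0//.
by rewrite log2_ge1// (ler_nat _ 2).
Qed.

Lemma class_error_rate (a b : R) (w : nat -> R) : 0 <= a ->
  (forall W, (2 <= W)%N -> 1 <= w W) ->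
  asymp_ge (entropy_number K) (fun n => rate b a n%:R) ->
  asymp_ge (class_error iota hs K w) (fun W => rate b a (W%:R * bits w W)).
Proof.
move=> a0 w1 [c0 c0_gt0 [N0 _ HN]].
have [A A0 HA] := entropy_le_class_error hs iota_cont.
set p : R := 4 * `|b| + 3 * a.
have p0 : 0 <= p by rewrite /p addr_ge0// mulr_ge0.
(* [k] bits per unit of [log2 P] make the rounding error O(P^-p / W), while the
   rate is at least P^-p. *)
set k := (Num.truncn p + 4)%N.
have kp : p + 3 <= k%:R.
  by have := truncnS_gt p; rewrite /k natrD -natr1; lra.
(* [M] will bound n / T: t <= S + 1 <= 2 S gives the 2, and [nparams d W] <= W (d + 3) gives the
   last factor. *)
pose M : R := (2 * k * (d + 3))%:R.
have M1 : 1 <= M by rewrite /M ler1n !muln_gt0 /k !addn_gt0 !orbT.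
have M0 : 0 < M by lra.
have [|c1 c1_gt0 Hc1] := @rate_comparable R 1 1 (log2 M + 1) M b a ltr01 ltr01 _ M0.
  by rewrite ltr_wpDl// log2_ge0.
(* Two errors of size c2 times the rate, from approximation and from rounding, must add up to
   strictly less than c0 c1 times the rate. *)
pose c2 := c0 * c1 / 4; have c2_gt0 : 0 < c2 by rewrite divr_gt0// mulr_gt0.
have c2_lt : 2 * c2 < c0 * c1.
  by have := mulr_gt0 c0_gt0 c1_gt0; rewrite /c2; lra.
exists c2 => //; near=> W.
have W2 : (2 <= W)%N by near: W; exact: nbhs_infty_ge.
have WN : (N0 <= W)%N by near: W; exact: nbhs_infty_ge.
(* Equivalently A / W <= c2, so the rounding error falls below c2 times the rate. *)
have WA : A / c2 <= W%:R by near: W; exact: nbhs_infty_ger.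
have W2R : 2 <= W%:R :> R by rewrite (ler_nat _ 2).
have wW := w1 W W2.
set P := W%:R * w W; set S := bits w W; set T := W%:R * S.
have P2 : 2 <= P by rewrite /P; nra.
have S1 : 1 <= S by exact: bits_ge1.
have SP : S = log2 P by rewrite /S /bits /P log2M//; lra.
have T2 : 2 <= T by rewrite /T; nra.
have TP : T <= P ^+ 3.
  have S2P : S <= 2 * P by rewrite SP log2_le//; lra.
  have WP : W%:R <= P by rewrite /P; nra.
  have : T <= P * (2 * P) by apply: ler_pM => //; lra.
  by rewrite !exprS expr0 mulr1; nra.
have rT := rate_ge_power b a0 P2 T2 TP; rewrite -/p in rT.
(* An integer between S and S + 1, so that [q] is a whole number of bits per parameter. *)
pose t := (Num.truncn S).+1.
have /andP[tS St] : (t%:R <= S + 1) && (S <= t%:R).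
  have /andP[u1 u2] := @truncn_itv R S (ltac:(lra)).
  by rewrite /t -natr1 in u2 *; apply/andP; split; lra.
pose q := (k * t)%N; pose n := (q * nparams d W)%N.
have /andP[np1 np2] := nparams_bounds (ltnW W2).
have k1 : 1 <= k%:R :> R by lra.
have Tn : T <= n%:R.
  rewrite /T /n mulnC natrM; apply: ler_pM; rewrite ?ler_nat//; try lra.
  by rewrite /q natrM; nra.
have nT : n%:R <= M * T.
  have : (nparams d W)%:R <= (W * (d + 3))%:R :> R by rewrite ler_nat.
  rewrite /n /q /M /T !natrM => h.
  rewrite [leRHS](_ : _ = (k%:R * (2 * S)) * (W%:R * (d + 3)%:R)); last by ring.
  by apply: ler_pM => //; rewrite ler_wpM2l//; lra.
have logT : 1 <= log2 T by exact: log2_ge1.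
(* Since log2 T >= 1, log2 (M T) <= (log2 M + 1) log2 T, so n and T also have comparable
   logarithms. *)
have rn : c1 * rate b a T <= rate b a n%:R.
  apply: Hc1; [lra|lra| |by rewrite mul1r Tn].
  rewrite mul1r le_log2//=; last lra.
  apply: (@le_trans _ _ (log2 (M * T))); first by rewrite le_log2//; lra.
  by rewrite log2M//; [have := log2_ge0 M1; nra|lra].
have Bpos : 0 < rate b a T by rewrite mulr_gt0 ?powR_gt0//; lra.
have Hent : ((c0 * rate b a n%:R)%:E <= entropy_number K n)%E.
  apply: HN => /=; rewrite (leq_trans WN)// (leq_trans np1)//.
  by rewrite leq_pmull// muln_gt0 /k addn_gt0 orbT.
(* If the class error were smaller, the covering bound at [n] would contradict [Hent]. *)
rewrite leNgt; apply/negP => Hlt.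
have := HA K w W q _ W2 wW (mulr_gt0 c2_gt0 Bpos) Hlt.
move=> /(le_trans Hent); rewrite lee_fin leNgt => /negP; apply.
have quant : A * W%:R * w W ^+ 2 / 2 ^+ q <= c2 * rate b a T.
  apply: le_trans (quantization_le _ wW A0 kp _) _; [lra|by rewrite -/P -SP|].
  apply: ler_pM => //; rewrite ?powR_ge0 ?divr_ge0 ?ler0n ?(ltW A0)//.
  by rewrite ler_pdivrMr; [rewrite mulrC -ler_pdivrMr|exact: lt_le_trans W2R].
apply: (@le_lt_trans _ _ (2 * (c2 * rate b a T))).
  by rewrite mulr_natl mulr2n lerD2l.
apply: lt_le_trans (ler_wpM2l (ltW c0_gt0) rn).
by rewrite mulrA [ltRHS]mulrA (ltr_pM2r Bpos).
Unshelve. all: by end_near. Qed.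

End LowerBound.

(** * Polynomially and exponentially growing parameter bounds *)

Section ParameterGrowth.
Variable R : realType.

Lemma rate0 (b x : R) : rate b 0 x = log2 x `^ b.
Proof. by rewrite /rate oppr0 powRr0 mulr1. Qed.

(** Here log2 W <= [bits] <= M log2 W, so the argument of the rate is comparable to W log2 W and its
    logarithm to log2 W. The maximum with 1 is taken because C may be below 1. *)
Lemma rate_polynomial (C delta a b : R) : 0 < C -> 0 <= delta ->
  exists2 c : R, 0 < c & forall W, (2 <= W)%N ->
    c * (log2 W%:R `^ (b - a) * W%:R `^ (- a)) <=
    rate b a (W%:R * bits (fun W => Num.max 1 (C * W%:R `^ delta)) W).
Proof.
move=> C0 delta0; set w := fun W : nat => _.
have lC : 0 <= log2 (1 + C) by rewrite log2_ge0// lerDl ltW.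
pose M := 1 + log2 (1 + C) + delta; have M1 : 1 <= M by rewrite /M; lra.
have lM : 0 <= log2 (2 * M) by rewrite log2_ge0//; lra.
have L0 : 0 < 2 + log2 (2 * M) by lra.
have [c c0 Hc] := rate_comparable b a ltr01 ltr01 L0 (lt_le_trans ltr01 M1).
exists c => // W W2; have W2R : 2 <= W%:R :> R by rewrite (ler_nat _ 2).
have W0 : 0 < W%:R :> R by lra.
set l := log2 W%:R; have l1 : 1 <= l by exact: log2_ge1.
have w1 : 1 <= w W by rewrite le_max lexx.
have S1 : l <= bits w W by rewrite lerDl log2_ge0.
have SM : bits w W <= M * l.
  rewrite /bits -/l /M; suff : log2 (w W) <= log2 (1 + C) + delta * l by nra.
  have Wd : 1 <= W%:R `^ delta :> R.
    by rewrite powR_ge1//; lra.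
  rewrite -log2_powR -log2M ?powR_gt0//; last lra.
  by rewrite le_log2 ?(lt_le_trans _ w1)// ge_max; apply/andP; split; nra.
have lW : l <= 2 * W%:R by exact: log2_le.
set S := bits w W in S1 SM *.
have logT : log2 (W%:R * S) = l + log2 S by rewrite log2M//; lra.
have l0 : 0 < l by lra.
(* Moves the -a in the logarithmic exponent into a power of W log2 W, the form of
   [rate_comparable]. *)
rewrite (_ : _ * _ `^ (- a) = l `^ b * (W%:R * l) `^ (- a)); last first.
  rewrite powRM ?(ltW W0) ?(ltW l0)// powRD; first by ring.
  by apply/implyP => _; rewrite gt_eqF.
apply: Hc; [exact: l0|exact: mulr_gt0| |].
  rewrite logT mul1r lerDl log2_ge0 ?(le_trans l1)//=.
  have : log2 S <= log2 (2 * M) + l.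
    by rewrite -log2M//; [apply: le_log2; nra|lra].
  by nra.
by rewrite mul1r ler_wpM2l ?(ltW W0)//= mulrCA ler_wpM2l ?(ltW W0).
Qed.

(** The term c W^nu dominates the logarithms, so the argument of the rate is comparable to W^(1+nu),
    whose logarithm is (1+nu) log2 W. *)
Lemma rate_exponential (C c nu a b : R) : 1 <= C -> 0 < c -> 0 < nu ->
  exists2 c' : R, 0 < c' & forall W, (2 <= W)%N ->
    c' * (log2 W%:R `^ b * W%:R `^ (- ((1 + nu) * a))) <=
    rate b a (W%:R * bits (fun W => C * 2 `^ (c * W%:R `^ nu)) W).
Proof.
move=> C1 c0 nu0; set w := fun W : nat => _.
have lC : 0 <= log2 C by rewrite log2_ge0.
pose M := 1 + 2 / nu + log2 C + c.
have nu2 : 0 < 2 / nu by exact: divr_gt0.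
have M1 : 1 <= M by rewrite /M; lra.
have lM : 0 <= log2 M by rewrite log2_ge0.
have L0 : 0 < 1 + nu + log2 M by lra.
have [c' c'0 Hc] := rate_comparable b a ltr01 c0 L0 (lt_le_trans ltr01 M1).
exists c' => // W W2; have W2R : 2 <= W%:R :> R by rewrite (ler_nat _ 2).
have W0 : 0 < W%:R :> R by lra.
set l := log2 W%:R; have l1 : 1 <= l by exact: log2_ge1.
have lw : log2 (w W) = log2 C + c * W%:R `^ nu.
  by rewrite /w log2M ?powR_gt0//; [rewrite log2_powR log2_2 mulr1|lra].
set V := W%:R `^ nu in lw.
have V1 : 1 <= V by rewrite powR_ge1//; lra.
(* Applying [log2_le] to W^nu instead of W shows that [l] is dominated by [V] for every nu > 0. *)
have lV : nu * l <= 2 * V by rewrite -log2_powR log2_le// powR_gt0.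
have {}lV : l <= 2 / nu * V by rewrite mulrAC ler_pdivlMr// mulrC.
have SE : bits w W = l + log2 C + c * V by rewrite /bits lw addrA.
set S := bits w W in SE *.
have S1 : l <= S by rewrite SE; nra.
have Sc : c * V <= S by rewrite SE; lra.
have SM : S <= M * V by rewrite SE /M; nra.
have WV : W%:R `^ (1 + nu) = W%:R * V.
  rewrite powRD ?powRr1// ?(ltW W0)//.
  by apply/implyP => _; rewrite gt_eqF.
rewrite -mulrN powRrM WV.
have V0 : 0 < V by lra.
apply: Hc; [lra|exact: mulr_gt0| |].
  have logT : log2 (W%:R * S) = l + log2 S by rewrite log2M//; lra.
  rewrite mul1r {1}logT lerDl log2_ge0 ?(le_trans l1)//=.
  apply: (@le_trans _ _ (log2 (M * W%:R `^ (1 + nu)))).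
    by rewrite le_log2 ?WV ?mulr_gt0 ?(lt_le_trans _ S1)//; nra.
  by rewrite log2M ?powR_gt0//; [rewrite log2_powR -/l; nra|lra].
by rewrite mulrCA ler_wpM2l ?(ltW W0)//= mulrCA ler_wpM2l ?(ltW W0).
Qed.

End ParameterGrowth.

(** * The rates for the three kinds of parameter bound *)

Theorem corollary5p8 (R : realType) (d : nat) (d_ge1 : (1 <= d)%N)
    (X : completeNormedModType R)
    (iota : {linear ccube R d -> X})
    (iota_inj : injective iota) (iota_cont : continuous iota)
    (K : set X) (K_compact : compact K)
    (sigma : R -> R) (sigma_act : activation sigma)
    (alpha beta : R) (alpha_gt0 : 0 < alpha) :
  (forall w : nat -> R, (forall W, (2 <= W)%N -> 1 <= w W) ->
     (asymp_ge (entropy_number K)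
        (fun n => log2 n%:R `^ beta / n%:R `^ alpha) ->
      asymp_ge (class_error iota sigma_act K w)
        (fun W => (log2 W%:R + log2 (log2 W%:R + log2 (w W))) `^ beta
                  / (W%:R * (log2 W%:R + log2 (w W))) `^ alpha))
     /\
     (asymp_ge (entropy_number K) (fun n => log2 n%:R `^ (- alpha)) ->
      asymp_ge (class_error iota sigma_act K w)
        (fun W => (log2 W%:R + log2 (log2 W%:R + log2 (w W))) `^ (- alpha))))
  /\
  (forall C delta : R, 0 < C -> 0 <= delta ->
     let w := fun W : nat => C * W%:R `^ delta in
     (asymp_ge (entropy_number K)
        (fun n => log2 n%:R `^ beta * n%:R `^ (- alpha)) ->
      asymp_ge (class_error iota sigma_act K w)
        (fun W => log2 W%:R `^ (beta - alpha) * W%:R `^ (- alpha)))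
     /\
     (asymp_ge (entropy_number K) (fun n => log2 n%:R `^ (- alpha)) ->
      asymp_ge (class_error iota sigma_act K w)
        (fun W => log2 W%:R `^ (- alpha))))
  /\
  (forall C c nu : R, 1 <= C -> 0 < c -> 0 < nu ->
     let w := fun W : nat => C * 2 `^ (c * W%:R `^ nu) in
     (asymp_ge (entropy_number K)
        (fun n => log2 n%:R `^ beta * n%:R `^ (- alpha)) ->
      asymp_ge (class_error iota sigma_act K w)
        (fun W => log2 W%:R `^ beta * W%:R `^ (- ((1 + nu) * alpha))))
     /\
     (asymp_ge (entropy_number K) (fun n => log2 n%:R `^ (- alpha)) ->
      asymp_ge (class_error iota sigma_act K w)
        (fun W => log2 W%:R `^ (- alpha)))).
Proof.
have main (a b : R) (w : nat -> R) : 0 <= a ->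
    (forall W, (2 <= W)%N -> 1 <= w W) ->
    asymp_ge (entropy_number K) (fun n => rate b a n%:R) ->
    asymp_ge (class_error iota sigma_act K w)
      (fun W => rate b a (W%:R * bits w W)).
  exact: class_error_rate.
have main_poly (a b C delta : R) : 0 <= a -> 0 < C -> 0 <= delta ->
    asymp_ge (entropy_number K) (fun n => rate b a n%:R) ->
    asymp_ge (class_error iota sigma_act K (fun W => C * W%:R `^ delta))
      (fun W => log2 W%:R `^ (b - a) * W%:R `^ (- a)).
  move=> a0 C0 delta0 HK; have [c c0 Hc] := rate_polynomial a b C0 delta0.
  (* The bound holds for max(1, C W^delta) and passes to the smaller C W^delta by
     antimonotonicity. *)
  apply: asymp_ge_le c0 Hc _ (main a b _ a0 _ HK) => W _.
    by apply: class_error_antimono; rewrite le_max lexx orbT.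
  by rewrite le_max lexx.
have main_exp (a b C c nu : R) : 0 <= a -> 1 <= C -> 0 < c -> 0 < nu ->
    asymp_ge (entropy_number K) (fun n => rate b a n%:R) ->
    asymp_ge (class_error iota sigma_act K
        (fun W => C * 2 `^ (c * W%:R `^ nu)))
      (fun W => log2 W%:R `^ b * W%:R `^ (- ((1 + nu) * a))).
  move=> a0 C1 c0 nu0 HK; have [c' c'0 Hc] := rate_exponential a b C1 c0 nu0.
  apply: asymp_ge_le c'0 Hc _ (main a b _ a0 _ HK) => // W _.
  rewrite -[leLHS]mulr1 ler_pM// powR_ge1 ?ler1n//.
  by rewrite mulr_ge0 ?powR_ge0// ltW.
have entropy0 : asymp_ge (entropy_number K) (fun n => log2 n%:R `^ (- alpha)) ->
    asymp_ge (entropy_number K) (fun n => rate (- alpha) 0 n%:R).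
  by under [fun n => rate _ _ _]eq_fun do rewrite rate0.
have al0 := ltW alpha_gt0.
have logbits w W : (forall W, (2 <= W)%N -> 1 <= w W) -> (2 <= W)%N ->
    log2 (W%:R * bits w W) = log2 W%:R + log2 (log2 W%:R + log2 (w W)) :> R.
  move=> w1 W2; rewrite log2M ?ltr0n ?(ltnW W2)//.
  by rewrite (lt_le_trans ltr01)// bits_ge1// w1.
split; [move=> w w1|split; [move=> C delta C0 delta0 w|move=> C c nu C1 c0 nu0 w]];
  split=> HK.
- have {}HK : asymp_ge (entropy_number K) (fun n => rate beta alpha n%:R).
    by under eq_fun do rewrite /rate powRN.
  apply: asymp_ge_le ltr01 _ _ (main alpha beta w al0 w1 HK) => // W W2.
  by rewrite mul1r /rate logbits// powRN.
- apply: asymp_ge_le ltr01 _ _ (main 0 (- alpha) w (lexx 0) w1 (entropy0 HK)) => // W W2.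
  by rewrite mul1r rate0 logbits.
- exact: main_poly.
- have := main_poly 0 (- alpha) C delta (lexx 0) C0 delta0 (entropy0 HK).
  apply: asymp_ge_le ltr01 _ _ => // W _.
  by rewrite mul1r subr0 oppr0 powRr0 mulr1.
- exact: main_exp.
- have := main_exp 0 (- alpha) C c nu (lexx 0) C1 c0 nu0 (entropy0 HK).
  apply: asymp_ge_le ltr01 _ _ => // W _.
  by rewrite mul1r mulr0 oppr0 powRr0 mulr1.
Qed.
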